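(* Let $n\ge 3$, let $A=\{1,2,\dots,n\}$, let $P_n=\{x_B : B\subseteq A\}$ be the commutative semigroup with multiplication $x_Bx_C=x_{B\cap C}$ (zero element $x_\emptyset$, identity element $1=x_A$), and let $\Gamma_n=\Gamma(P_n)$ be its zero-divisor graph. If $S$ is a commutative zero-divisor semigroup whose zero-divisor graph $\Gamma(S)$ is isomorphic to $\Gamma_n$, then $S$ is isomorphic as a semigroup to the zero-divisor semigroup $P_n-\{1\}$.
   Context: All semigroups are commutative, written multiplicatively, and have a zero element $0$ (so $0x=0$ for all $x$). An element $x$ of a semigroup $S$ is a zero-divisor if $xy=0$ for some $y\in S$ with $y\ne 0$. A zero-divisor semigroup is a commutative semigroup with $0$ all of whose elements are zero-divisors. The zero-divisor graph $\Gamma(S)$ is the undirected simple graph whose vertices are the nonzero zero-divisors of $S$, two distinct vertices $x,y$ being adjacent if and only if $xy=0$. Here the elements $x_B$, $B\subseteq A$, of $P_n$ are pairwise distinct; thus the vertices of $\Gamma_n$ are the $x_B$ with $B$ a nonempty proper subset of $A$, and distinct $x_B,x_C$ are adjacent iff $B\cap C=\emptyset$. *)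

(* Defs.v *)
From HB Require Import structures.
From mathcomp Require Import all_boot.
From mathcomp Require Import boolp.

Set Implicit Arguments.
Unset Strict Implicit.
Unset Printing Implicit Defensive.

Local Open Scope group_scope.

HB.mixin Record Semigroup_isComWithZero S of Semigroup S := {
  zerog : S;
  mulgC : commutative (@mul S);
  mul0g : left_zero zerog (@mul S)
}.

#[short(type="comZeroSemigroupType")]
HB.structure Definition ComZeroSemigroup :=
  {S of Semigroup_isComWithZero S & Semigroup S}.

Notation "0" := (@zerog _) : group_scope.

Definition zero_divisor (S : comZeroSemigroupType) (x : S) : Prop :=
  exists y : S, y <> 0 /\ x * y = 0.

Definition zero_divisor_semigroup (S : comZeroSemigroupType) : Prop :=
  forall x : S, zero_divisor x.

Definition semigroup_isomorphic (S T : semigroupType) : Prop :=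
  exists f : {multiplicative S -> T}, bijective f.

Record sgraph := SGraph {
  vertex :> Type;
  adj : rel vertex;
  adj_sym : symmetric adj;
  adj_irrefl : irreflexive adj
}.

Definition graph_isomorphic (G H : sgraph) : Prop :=
  exists f : G -> H,
    bijective f /\ forall u v : G, adj (f u) (f v) = adj u v.

Section ZeroDivisorGraph.
Variable S : comZeroSemigroupType.

(* [asbool] makes the vertex predicate boolean, so that two vertices with the
   same underlying element are equal. *)
Definition zd_vertex : Type := {x : S | `[< x <> 0 /\ zero_divisor x >]}.

Definition zd_adj : rel zd_vertex :=
  fun u v => (val u != val v) && (val u * val v == 0).

Fact zd_adj_sym : symmetric zd_adj.
Proof. by move=> u v; rewrite /zd_adj eq_sym mulgC. Qed.

Fact zd_adj_irrefl : irreflexive zd_adj.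
Proof. by move=> u; rewrite /zd_adj eqxx. Qed.

Definition zero_divisor_graph : sgraph := SGraph zd_adj_sym zd_adj_irrefl.

End ZeroDivisorGraph.

(* The element x_B is represented by B itself. The alias keeps this product
   apart from the elementwise product on sets of group elements. *)
Definition Pn (n : nat) : Type := {set 'I_n}.

HB.instance Definition _ n := Finite.copy (Pn n) {set 'I_n}.
HB.instance Definition _ n :=
  isMonoid.Build (Pn n) (@setIA 'I_n) (@setTI 'I_n) (@setIT 'I_n).
HB.instance Definition _ n :=
  Semigroup_isComWithZero.Build (Pn n) (@setIC 'I_n) (@set0I 'I_n).

Definition Pn_minus_one (n : nat) : Type := {x : Pn n | x != 1}.

HB.instance Definition _ n := SubFinite.on (Pn_minus_one n).

Fact Pn_minus_one_closed n : mulg_closed [pred x : Pn n | x != 1].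
Proof.
move=> x y x1 _; apply: contraNN x1 => /eqP xy1.
by apply/eqP/setP=> i; have /setP/(_ i) := xy1; rewrite !inE => /andP[].
Qed.

HB.instance Definition _ n :=
  SubChoice_isSubSemigroup.Build (Pn n) (fun x => x != 1) (Pn_minus_one n)
    (@Pn_minus_one_closed n).

(* Main.v *)
From HB Require Import structures.
Require Import Defs.
From mathcomp Require Import all_boot.
From mathcomp Require Import boolp.

(** An isomorphism of the zero-divisor graphs labels each nonzero element [x] of
[S] with a nonempty proper subset [L x] of [{1, ..., n}]; label [0] with the empty
set. Distinct elements then have product [0] exactly when their labels are
disjoint, and the task is to recover the whole multiplication from this.

The graph says nothing about squares, so the first point is that [S] has no
nonzero element of square zero ([nilfree]). Whatever annihilates [x] annihilates
[x * y]; applied to the element labelled by the complement of [L x], this forces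
[L (x * y)] to be that complement or to lie inside [L x] ([label_mul_dichotomy]).
If [x * x = 0] then [x] itself annihilates [x * y], which leaves so little room
that [x * y = x] for suitable [y] ([absorb_of_square0]), and a contradiction
follows by choosing [y] among elements with one- and two-element labels; the
latter are available because [n] is at least 3.

Hence [x * y = 0] exactly when the labels are disjoint, also for [x = y]. Writing
[e i] for the element labelled [{i}], membership of [i] in [L z] now means
[e i * z != 0], and in that case [e i * z = e i], since the label of [e i * z] is
then a nonempty subset of [{i}]. So the [e i] see products as intersections
([label_mul]), and [L] is the required isomorphism. *)

Section Labelling.

Local Open Scope group_scope.

Variables (S : comZeroSemigroupType) (T : finType) (L : S -> {set T}).
Hypothesis L_inj : injective L.
Hypothesis L_proper : forall x, L x != [set: T].
Hypothesis L_onto : forall B : {set T}, B != [set: T] -> exists x, L x = B.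
Hypothesis L0 : L 0 = set0.
Hypothesis L_adj : forall x y, x != y -> (x * y == 0) = [disjoint L x & L y].

Lemma label_eq0 x : (L x == set0) = (x == 0).
Proof. by rewrite -L0 (inj_eq L_inj). Qed.

Lemma mulg0 (x : S) : x * 0 = 0.
Proof. by rewrite mulgC mul0g. Qed.

(** The element labelled by the complement of [L x] annihilates [x], hence [x * y]: either
it is equal to [x * y], or the two labels are disjoint. *)
Lemma label_mul_dichotomy x y : L (x * y) = ~: L x \/ L (x * y) \subset L x.
Proof.
have [->|x0] := eqVneq x 0; first by right; rewrite mul0g.
have [|z Lz] := L_onto (~: L x).
  by apply: contraNneq x0 => Lx; rewrite -label_eq0 -[L x]setCK Lx setCT.
have zx : z * x = 0.
  apply/eqP; rewrite L_adj; last first.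
    apply: contraNneq (L_proper x) => E; move: Lz.
    rewrite E => /setP E'; apply/eqP/setP => i.
    by have := E' i; rewrite !inE; case: (i \in L x).
  by rewrite Lz -setI_eq0 setIC setICr.
have zxy : z * (x * y) == 0 by rewrite mulgA zx mul0g.
have [<-|nz] := eqVneq z (x * y); first by left.
by right; move: zxy; rewrite L_adj // Lz disjoints_subset setCS.
Qed.

(** Here [x] annihilates [x * y], so by the dichotomy for [x] the label of [x * y] is
[L x] or its complement; the dichotomy for [y] leaves only the first case. *)
Lemma absorb_of_square0 x y :
  x * x = 0 -> x != y -> ~~ [disjoint L x & L y] -> ~~ (~: L x \subset L y) ->
  L x \subset L y /\ x * y = x.
Proof.
move=> xx nxy meet ncov.
have xy0 : x * y != 0 by rewrite L_adj.
have Lxy : x * y = x \/ L (x * y) = ~: L x.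
  have [E|nE] := eqVneq x (x * y); first by left.
  have : x * (x * y) == 0 by rewrite mulgA xx mul0g.
  rewrite L_adj // => dis; case: (label_mul_dichotomy x y) => [|sub]; first by right.
  case/negP: xy0; rewrite -label_eq0 -subset0 -(setICr (L x)) subsetI sub.
  by rewrite -disjoints_subset disjoint_sym.
have := label_mul_dichotomy y x; rewrite [y * x]mulgC.
case: Lxy => E; rewrite E => -[E'|sub].
- by case/negP: meet; rewrite E' -setI_eq0 setIC setICr.
- by [].
- by case/negP: nxy; apply/eqP/L_inj/setC_inj.
- by case/negP: ncov.
Qed.

Hypothesis T_gt2 : 2 < #|T|.

Lemma pair_neqT (a b : T) : [set a; b] != [set: T].
Proof.
apply: contraTneq T_gt2 => E.
by rewrite -cardsT -E cards2 -leqNgt; case: (a != b).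
Qed.

Lemma set1_neqT (a : T) : [set a] != [set: T].
Proof. by have := pair_neqT a a; rewrite setUid. Qed.

(** A label of two or more elements is excluded because the element labelled [{b}] would
then meet [x] without containing [L x]; its label cannot contain the complement of [L x]
either, as [{b}] together with [L x] is not everything. *)
Lemma square0_label_set1 x b : x * x = 0 -> b \in L x -> L x = [set b].
Proof.
move=> xx bx; have [y Ly] := L_onto _ (set1_neqT b).
have [->//|nxy] := eqVneq x y.
have meet : ~~ [disjoint L x & L y].
  by rewrite Ly disjoint_sym disjoints1 bx.
have [|sub _] := absorb_of_square0 _ _ xx nxy meet.
  apply: contraNN (L_proper x) => cov; rewrite -subTset -(setUCr (L x)) subUset subxx.
  by rewrite (subset_trans cov) // Ly sub1set.
by apply/eqP; rewrite eqEsubset sub1set bx -Ly sub.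
Qed.

(** A nonzero [x] of square zero would be labelled by some [{b}] and satisfy [x * y = x]
for every [y] labelled [{b, c}] with [c != b]. Take such [y] and [z] for two different
values [c] and [d]. Their product is not annihilated by [x], so its label contains [b],
and it lies inside [{b, c} :&: {b, d} = {b}]; so [y * z = x], and then
[x = x * y * z = x * x = 0]. *)
Lemma nilfree (x : S) : x * x = 0 -> x = 0.
Proof.
move=> xx; apply/eqP; rewrite -label_eq0; apply: contraT => /set0Pn[b bx].
have Lx := square0_label_set1 _ _ xx bx.
have [c cb] : exists c : T, c \notin [set b].
  by have := set1_neqT b; rewrite -subTset => /subsetPn[c _ cb]; exists c.
have [d db] : exists d : T, d \notin [set b; c].
  by have := pair_neqT b c; rewrite -subTset => /subsetPn[d _ db]; exists d.
move: cb db; rewrite !inE negb_or => cb /andP[db dc].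
have [y Ly] := L_onto _ (pair_neqT b c).
have [z Lz] := L_onto _ (pair_neqT b d).
have absorb w e f : L w = [set b; e] -> e != b -> f != b -> f != e -> x * w = x.
  move=> Lw eb fb fe; have [] // := @absorb_of_square0 x w xx.
  - by apply: contraNneq eb => xw; rewrite -in_set1 -Lx xw Lw set22.
  - by rewrite Lx disjoints1 Lw set21.
  - by apply/subsetPn; exists f; rewrite ?Lx ?Lw !inE ?negb_or fb.
have xy := absorb _ _ _ Ly cb db dc.
have xz : x * z = x by apply: (absorb z d c); rewrite // eq_sym.
have xyz : x * (y * z) = x by rewrite mulgA xy xz.
have x0 : x != 0 by rewrite -label_eq0; apply/set0Pn; exists b.
have [E|nE] := eqVneq x (y * z); first by case/eqP: x0; rewrite -xx {3}E xyz.
have byz : b \in L (y * z).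
  by move: x0; rewrite -{1}xyz L_adj // Lx disjoints1 negbK.
have suby : L (y * z) \subset L y.
  by case: (label_mul_dichotomy y z) => // E; move: byz; rewrite E Ly !inE eqxx.
have subz : L (y * z) \subset L z.
  rewrite mulgC in byz *.
  by case: (label_mul_dichotomy z y) => // E; move: byz; rewrite E Lz !inE eqxx.
case/eqP: nE; apply: L_inj; apply/esym/eqP; rewrite Lx eqEsubset sub1set byz andbT.
apply/subsetP=> i iyz; have := subsetP suby i iyz; have := subsetP subz i iyz.
rewrite Ly Lz !inE; case: (i == b) => //= /eqP-> E.
by rewrite E in dc.
Qed.

Lemma mul_eq0_label x y : (x * y == 0) = [disjoint L x & L y].
Proof.
have [<-|/L_adj//] := eqVneq x y.
rewrite -setI_eq0 setIid label_eq0.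
by apply/eqP/eqP => [/nilfree|->]; rewrite ?mul0g.
Qed.

(** With [e] labelled [{i}], [i \in L z] means [e * z != 0], and then [e * z = e]; so when
[i] lies in both labels, [e * (x * y) = e * y != 0]. *)
Lemma label_mul : {morph L : x y / x * y >-> x :&: y}.
Proof.
move=> x y; apply/setP => i; have [e Le] := L_onto _ (set1_neqT i).
have inL z : (i \in L z) = (e * z != 0) by rewrite mul_eq0_label Le disjoints1 negbK.
have eM z : i \in L z -> e * z = e.
  (* [e * z] is nonzero and annihilated by every element labelled [{j}], [j != i]. *)
  move=> iz; apply: L_inj; have ez0 : e * z != 0 by rewrite -inL.
  have sub : L (e * z) \subset [set i].
    apply/subsetP => j; apply: contraLR; rewrite !inE => ji.
    have [f Lf] := L_onto _ (set1_neqT j).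
    have ef : f * e = 0.
      by apply/eqP; rewrite mul_eq0_label Le Lf disjoints1 inE.
    have : f * (e * z) == 0 by rewrite mulgA ef mul0g.
    by rewrite mul_eq0_label Lf disjoints1.
  rewrite Le; apply/eqP; move: sub; rewrite subset1 label_eq0 (negPf ez0).
  by rewrite orbF.
rewrite inE; apply/idP/andP => [|[ix iy]]; last first.
  by rewrite inL mulgA eM // -inL.
by rewrite !inL mulgA => exy; split; apply: contraNneq exy => E;
  rewrite ?E ?mul0g // -mulgA [x * y]mulgC mulgA E mul0g.
Qed.

End Labelling.

(** The vertices of the graph of [Pn n] are the nonempty proper subsets: the
complement is a nonzero annihilator. *)
Lemma Pn_vertexP (n : nat) (B : Pn n) :
  (B <> 0 /\ zero_divisor B)%g <-> (B != set0) && (B != [set: 'I_n]).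
Proof.
split=> [[/eqP B0 [C [/eqP C0 BC]]]|/andP[B0 BT]].
  rewrite [_ != set0]B0 /=; apply: contraNneq C0 => BT.
  by rewrite -BC BT; apply/eqP/esym/setTI.
split; first exact/eqP.
exists (~: B : {set 'I_n}); split; last exact: setICr.
move/eqP => E; case/negP: BT; rewrite -[B : {set _}]setCK; apply/eqP.
by rewrite (eqP E) -[RHS]setC0.
Qed.

(** The labelling follows the graph isomorphism on the nonzero elements, all of which are
vertices since every element of [S] is a zero-divisor; [0], which is no vertex, gets the
empty set, the subset that the graph of [Pn n] leaves out besides the full one. *)
Lemma exists_label (n : nat) (S : comZeroSemigroupType) :
  zero_divisor_semigroup S ->
  graph_isomorphic (zero_divisor_graph S) (zero_divisor_graph (Pn n)) ->
  0 < n ->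
  exists L : S -> {set 'I_n},
    [/\ injective L, forall x, L x != [set: 'I_n],
        forall B : {set 'I_n}, B != [set: 'I_n] -> exists x, L x = B,
        L 0%g = set0
      & forall x y, x != y -> (x * y == 0)%g = [disjoint L x & L y]].
Proof.
move=> S_zd [f [f_bij f_adj]] n_gt0; have [g fK gK] := f_bij.
pose L (x : S) : {set 'I_n} :=
  oapp (fun v : zd_vertex S => val (f v) : {set 'I_n}) set0 (insub x).
have vP (v : zd_vertex S) : (val v != 0)%g.
  by have /asboolP[/eqP] := valP v.
have LE v : L (val v) = val (f v) by rewrite /L valK.
have L0 : L 0%g = set0.
  by rewrite /L insubF //; apply/asboolP => -[].
have LP (x : S) : x = 0%g \/ exists v : zd_vertex S, x = val v.
  have [->|/eqP x0] := eqVneq x 0%g; [by left | right].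
  have xP : `[< x <> 0%g /\ zero_divisor x >] by apply/asboolP; split.
  by exists (Sub x xP); rewrite SubK.
have fP v :
  (val (f v) != set0 :> {set 'I_n}) && (val (f v) != [set: 'I_n] :> {set 'I_n}).
  by apply/Pn_vertexP/asboolP; apply: valP (f v).
exists L; split.
- move=> x y; case: (LP x) => [->|[u ->]]; case: (LP y) => [->|[v ->]] //.
  + by rewrite L0 LE => E; have := fP v; rewrite -E eqxx.
  + by rewrite L0 LE => E; have := fP u; rewrite E eqxx.
  + by rewrite !LE => /val_inj/(can_inj fK)->.
- move=> x; case: (LP x) => [->|[u ->]].
    by rewrite L0; apply/eqP => /setP/(_ (Ordinal n_gt0)); rewrite !inE.
  by rewrite LE; case/andP: (fP u).
- move=> B BT; have [->|B0] := eqVneq B set0; first by exists 0%g.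
  have BP : `[< (B : Pn n) <> 0%g /\ zero_divisor (B : Pn n) >].
    by apply/asboolP/Pn_vertexP; rewrite B0.
  exists (val (g (exist _ (B : Pn n) BP))).
  by rewrite LE gK.
- exact: L0.
- move=> x y; case: (LP x) => [->|[u ->]].
    by rewrite L0 mul0g eqxx -setI_eq0 set0I eqxx.
  case: (LP y) => [->|[v ->]].
    by rewrite L0 mulgC mul0g eqxx -setI_eq0 setI0 eqxx.
  move=> nuv; have := f_adj u v; rewrite /= /zd_adj nuv /= => <-.
  have -> : val (f u) != val (f v).
    by apply: contraNneq nuv => /val_inj/(can_inj fK)->.
  by rewrite !LE -setI_eq0.
Qed.

Theorem theorem2p2 (n : nat) (n_ge3 : 3 <= n) (S : comZeroSemigroupType)
    (S_zd : zero_divisor_semigroup S)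
    (S_graph : graph_isomorphic (zero_divisor_graph S)
                                (zero_divisor_graph (Pn n))) :
  semigroup_isomorphic S (Pn_minus_one n).
Proof.
have n_gt0 : 0 < n by apply: leq_trans n_ge3.
have [L [L_inj L_proper L_onto L0 L_adj]] := exists_label n S S_zd S_graph n_gt0.
have T_gt2 : 2 < #|'I_n| by rewrite card_ord.
have LM := label_mul S _ L L_inj L_proper L_onto L0 L_adj T_gt2.
pose h (x : S) : Pn_minus_one n := exist _ (L x : Pn n) (L_proper x).
have hM : {morph h : x y / (x * y)%g >-> (x * y)%g}.
  by move=> x y; apply: val_inj; rewrite valM; apply: LM.
pose hm := isMultiplicative.Build _ _ h hM.
pose H : {multiplicative S -> Pn_minus_one n} := HB.pack h hm.
have pre (B : Pn_minus_one n) : exists x, L x == val B :> {set 'I_n}.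
  by have [x <-] := L_onto (val B) (valP B); exists x.
exists H; exists (fun B => xchoose (pre B)) => [x|B].
  by apply: L_inj; apply/eqP; apply: (xchooseP (pre (h x))).
by apply: val_inj; apply/eqP; apply: (xchooseP (pre B)).
Qed.
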